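(* Let $\mathcal{P}$ be any index-invariant property of distributions over $\{0,1\}^n$ that is $\varepsilon$-testable by an adaptive algorithm using $s$ samples and $q$ queries, where $s,q$ are integers. Then $\mathcal{P}$ can be $\varepsilon$-tested by a non-adaptive algorithm using $s$ samples and $sq\le q^2$ queries.
   Context: Huge object model: an algorithm takes independent samples $\mathbf{V}_1,\dots,\mathbf{V}_s$ from the unknown distribution $D$ over $\{0,1\}^n$ and queries coordinates of the samples. Adaptive: each query depends on the random coins and previous answers. Non-adaptive: the random coins determine sets $J_1,\dots,J_s\subseteq[n]$ in advance, the algorithm reads $\mathbf{V}_i|_{J_i}$ and decides. $\varepsilon$-testing: accept every $D\in\mathcal{P}$ and reject every $D$ whose Earth Mover Distance (w.r.t. normalized Hamming distance) from $\mathcal{P}$ exceeds $\varepsilon$, each with probability at least $2/3$. For a permutation $\sigma$ of $[n]$, $D_\sigma$ satisfies $D(w_1,\dots,w_n)=D_\sigma(w_{\sigma(1)},\dots,w_{\sigma(n)})$; $\mathcal{P}$ is index-invariant if $D\in\mathcal{P}\iff D_\sigma\in\mathcal{P}$ for all $D$ and $\sigma$. *)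

(* Defs.v *)
From HB Require Import structures.
From mathcomp Require Import all_boot all_order perm all_algebra.
From mathcomp Require Import all_classical all_reals ereal.

Set Implicit Arguments.
Unset Strict Implicit.
Unset Printing Implicit Defensive.

Import Order.TTheory GRing.Theory Num.Theory.
Local Open Scope classical_set_scope.
Local Open Scope ring_scope.

Record distr (R : realType) (T : finType) := Distr {
  dfun :> {ffun T -> R};
  dfunP : [forall x, 0 <= dfun x] && (\sum_x dfun x == 1) }.

HB.instance Definition _ (R : realType) (T : finType) :=
  [isSub for @dfun R T].

Notation bits n := {ffun 'I_n -> bool}.

Definition hamming (R : realType) (n : nat) (x y : bits n) : R :=
  #|[set j | x j != y j]%SET|%:R / n%:R.

Definition coupling (R : realType) (T : finType) (D E : distr R T) :
    set (distr R (T * T)%type) :=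
  [set c : distr R (T * T)%type | (forall x, \sum_y c (x, y) = D x) /\
                                   (forall y, \sum_x c (x, y) = E y)].

Definition emd (R : realType) (n : nat) (D E : distr R (bits n)) : R :=
  inf [set \sum_x \sum_y c (x, y) * hamming R x y | c in coupling D E].

(* Extended-real valued, so that every distribution is at distance +oo from
   the empty property. *)
Definition emd_to (R : realType) (n : nat) (D : distr R (bits n))
    (P : set (distr R (bits n))) : \bar R :=
  ereal_inf [set (emd D E)%:E | E in P].

(* The hypothesis on D and D' determines D' uniquely: it is D_sigma. *)
Definition index_invariant (R : realType) (n : nat)
    (P : set (distr R (bits n))) : Prop :=
  forall (D D' : distr R (bits n)) (sigma : {perm 'I_n}),
    (forall w : bits n, D w = D' [ffun i => w (sigma i)]) ->
    (P D <-> P D').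

Notation samples s n := {ffun 'I_s -> bits n}.

(* Probability of the event [E coins samples]: coins are drawn from mu, and
   independently the s samples are drawn i.i.d. from D. *)
Definition prob (R : realType) (n s : nat) (Omega : finType)
    (mu : distr R Omega) (D : distr R (bits n))
    (E : Omega -> samples s n -> bool) : R :=
  \sum_(w : Omega) \sum_(x : samples s n)
    mu w * (\prod_(i < s) D (x i)) * (E w x)%:R.

Definition eps_tests (R : realType) (n s : nat) (eps : R)
    (P : set (distr R (bits n))) (Omega : finType) (mu : distr R Omega)
    (accepts : Omega -> samples s n -> bool) : Prop :=
  (forall D, P D -> 2 / 3 <= prob mu D accepts) /\
  (forall D, (eps%:E < emd_to D P)%E ->
     2 / 3 <= prob mu D (fun w x => ~~ accepts w x)).

(* A deterministic adaptive algorithm: [Query i j t0 t1] reads coordinate j of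
   sample i and continues with t1 if the answer is true, t0 otherwise. *)
Inductive dtree (s n : nat) :=
  | Decide of bool
  | Query of 'I_s & 'I_n & dtree s n & dtree s n.

Fixpoint depth (s n : nat) (t : dtree s n) : nat :=
  if t is Query _ _ t0 t1 then (maxn (depth t0) (depth t1)).+1 else 0%N.

Fixpoint run (s n : nat) (t : dtree s n) (x : samples s n) : bool :=
  match t with
  | Decide b => b
  | Query i j t0 t1 => if x i j then run t1 x else run t0 x
  end.

(* Coins range over a finite space with arbitrary real weights. This is no
   restriction: for fixed s, n, q there are finitely many deterministic
   algorithms, and only their distribution matters. *)
Definition adaptively_testable (R : realType) (n : nat) (eps : R)
    (P : set (distr R (bits n))) (s q : nat) : Prop :=
  exists (Omega : finType) (mu : distr R Omega) (A : Omega -> dtree s n),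
    (forall w, (depth (A w) <= q)%N) /\
    eps_tests eps P mu (fun w x => run (A w) x).

Definition view (s n : nat) (J : 'I_s -> {set 'I_n}) (x : samples s n) :
    {ffun 'I_s -> {ffun 'I_n -> option bool}} :=
  [ffun i => [ffun j => if j \in J i then Some (x i j) else None]].

Definition nonadaptively_testable (R : realType) (n : nat) (eps : R)
    (P : set (distr R (bits n))) (s q : nat) : Prop :=
  exists (Omega : finType) (mu : distr R Omega)
         (J : Omega -> 'I_s -> {set 'I_n})
         (decide : Omega -> {ffun 'I_s -> {ffun 'I_n -> option bool}} -> bool),
    (forall w, (\sum_(i < s) #|J w i| <= q)%N) /\
    eps_tests eps P mu (fun w x => decide w (view (J w) x)).

(* Main.v *)
(* Shuffle the samples and the coordinates by independent uniform permutations
   tau and sigma and run the adaptive algorithm. The samples being i.i.d.,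
   this amounts to running it on D_sigma, which is in P, resp. far from P, iff
   D is. After the shuffle, a sample or coordinate met for the first time is
   uniform among those not met yet, so its label is irrelevant: the acceptance
   probability does not change if each branch of the decision tree is relabelled
   so that samples and coordinates are met in the order 0, 1, 2, ... The
   relabelled tree only reads coordinates below q of samples below q, hence it
   can be simulated non-adaptively with min(s, q) * q queries. *)
Require Import Defs.
From mathcomp Require Import all_boot all_order perm all_algebra.
From mathcomp Require Import all_classical all_reals ereal.
From mathcomp Require Import ring.

Set Implicit Arguments.
Unset Strict Implicit.
Unset Printing Implicit Defensive.

Import Order.TTheory GRing.Theory Num.Theory.
Local Open Scope classical_set_scope.
Local Open Scope ring_scope.

(** * Shuffling samples and coordinates *)

Definition perm_bits n (sigma : 'S_n) (w : bits n) : bits n :=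
  [ffun j => w (sigma j)].

Definition perm_samples s n (tau : 'S_s) (sigma : 'S_n) (x : samples s n) :
    samples s n := [ffun i => perm_bits sigma (x (tau i))].

Lemma perm_samplesE s n (tau : 'S_s) (sigma : 'S_n) (x : samples s n) i j :
  perm_samples tau sigma x i j = x (tau i) (sigma j).
Proof. by rewrite !ffunE. Qed.

Lemma perm_bitsK n (sigma : 'S_n) :
  cancel (perm_bits sigma) (perm_bits sigma^-1).
Proof. by move=> w; apply/ffunP => j; rewrite !ffunE permKV. Qed.

Lemma perm_bitsVK n (sigma : 'S_n) :
  cancel (perm_bits sigma^-1) (perm_bits sigma).
Proof. by move=> w; apply/ffunP => j; rewrite !ffunE permK. Qed.

Lemma perm_bits_bij n (sigma : 'S_n) : bijective (perm_bits sigma).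
Proof. exact: Bijective (@perm_bitsK n sigma) (@perm_bitsVK n sigma). Qed.

Lemma perm_samples_bij s n (tau : 'S_s) (sigma : 'S_n) :
  bijective (perm_samples tau sigma).
Proof.
exists (perm_samples tau^-1 sigma^-1) => x; apply/ffunP => i; apply/ffunP => j.
  by rewrite !ffunE !permKV.
by rewrite !ffunE !permK.
Qed.

(** * Relabelling decision trees in order of first use *)

Section Canonical.
Variables s n : nat.

(** The minimum of [i] and [k] stays in ['I_m] even if [k >= m], and it makes the swap in [fresh]
    trivial when [p i <= k]. *)
Definition ord_cap m (i : 'I_m) (k : nat) : 'I_m :=
  Ordinal (leq_ltn_trans (geq_minl i k) (ltn_ord i)).

(* If [p] sends the points met so far into [0, k), then so does [fresh k p i],
   with the same values, and it sends the new point [i] to at most [k]. *)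
Definition fresh m (k : nat) (p : 'S_m) (i : 'I_m) : 'S_m :=
  (p * tperm (p i) (ord_cap (p i) k))%g.

Lemma fresh_le m k (p : 'S_m) i : (fresh k p i i <= k)%N.
Proof. by rewrite /fresh permM tpermL geq_minr. Qed.

(** Either [i < k] and the swap is trivial, or it exchanges [i] and [k], neither of which is below
    [k]. *)
Lemma tperm_cap m k (i j : 'I_m) :
  (j < k)%N -> tperm i (ord_cap i k) j = j.
Proof.
move=> jk; have [ik|ki] := ltnP i k.
  suff -> : ord_cap i k = i by rewrite tperm1 perm1.
  by apply: val_inj; rewrite /= (minn_idPl (ltnW ik)).
apply: tpermD; apply: contraTneq jk => <-; rewrite -leqNgt //=.
by rewrite (minn_idPr ki).
Qed.

(* The tree [t] with samples and coordinates renamed along each branch in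
   order of first use, given the renamings of those met in [k] queries. *)
Fixpoint canon (k : nat) (tau : 'S_s) (sigma : 'S_n) (t : dtree s n) :
    dtree s n :=
  match t with
  | Decide b => Decide s n b
  | Query i j t0 t1 =>
      let tau' := fresh k tau i in let sigma' := fresh k sigma j in
      Query (tau' i) (sigma' j)
        (canon k.+1 tau' sigma' t0) (canon k.+1 tau' sigma' t1)
  end.

(** By [fresh_le] the first query has labels at most [k], and each further query raises this bound
    by one. *)
Lemma run_canon_local k tau sigma t (x y : samples s n) :
    (forall (i : 'I_s) (j : 'I_n), (i < k + depth t)%N -> (j < k + depth t)%N ->
      x i j = y i j) ->
  run (canon k tau sigma t) x = run (canon k tau sigma t) y.
Proof.
elim: t k tau sigma => [//|i j t0 IH0 t1 IH1] k tau sigma /= xy.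
have le_k : (k < k + (maxn (depth t0) (depth t1)).+1)%N.
  by rewrite addnS ltnS leq_addr.
rewrite -xy ?(leq_ltn_trans (fresh_le _ _ _) le_k)//.
by case: ifP => _; [apply: IH1 | apply: IH0] => i' j' hi hj; apply: xy;
  [apply: leq_trans hi _ | apply: leq_trans hj _
  |apply: leq_trans hi _ | apply: leq_trans hj _];
  rewrite addSnnS leq_add2l ltnS ?leq_maxl ?leq_maxr.
Qed.

(* The weight [f] depends only on the values of the permutations below [k], so
   it can absorb the indicator of each answer; the induction step then only
   relabels the part of the permutations that is still free. *)
Lemma sum_run_canon (R : comNzRingType) (G : bool -> R) (x : samples s n)
    t k (tau0 : 'S_s) (sigma0 : 'S_n) (f : 'S_s -> 'S_n -> R) :
    (forall (tau tau' : 'S_s) (sigma sigma' : 'S_n),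
      (forall i : 'I_s, (i < k)%N -> tau i = tau' i) ->
      (forall j : 'I_n, (j < k)%N -> sigma j = sigma' j) ->
      f tau sigma = f tau' sigma') ->
  \sum_tau \sum_sigma
    f tau sigma * G (run (canon k tau0 sigma0 t) (perm_samples tau sigma x)) =
  \sum_tau \sum_sigma
    f tau sigma * G (run t (perm_samples (tau0 * tau)%g (sigma0 * sigma)%g x)).
Proof.
elim: t k tau0 sigma0 f => [//|i j t0 IH0 t1 IH1] k tau0 sigma0 f f_loc.
pose tau1 := fresh k tau0 i; pose sigma1 := fresh k sigma0 j.
transitivity (\sum_tau \sum_sigma f tau sigma * G (run (Query i j t0 t1)
    (perm_samples (tau1 * tau)%g (sigma1 * sigma)%g x))); last first.
  (* Absorb the swaps of [fresh] into [tau] and [sigma]: they fix all points below [k], so [f] does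
     not change. *)
  symmetry; rewrite (reindex_inj (mulgI (tperm (tau0 i) (ord_cap (tau0 i) k)))).
  apply: eq_bigr => tau _.
  rewrite (reindex_inj (mulgI (tperm (sigma0 j) (ord_cap (sigma0 j) k)))).
  apply: eq_bigr => sigma _; rewrite !mulgA; congr (_ * _).
  by apply: f_loc => l lk; rewrite permM tperm_cap.
have splitE (b : bool) (a : R) (c d : bool) :
    a * G (if b then c else d) = a * b%:R * G c + a * (~~ b)%:R * G d.
  by case: b; rewrite /= mulr1 mulr0 mul0r ?addr0 ?add0r.
(* The answer to the first query, common to both trees. It involves the permutations only at points
   at most [k], so [f] times its indicator is a valid weight for [k.+1]. *)
pose ans (tau : 'S_s) (sigma : 'S_n) := x (tau (tau1 i)) (sigma (sigma1 j)).
have ans_loc (tau tau' : 'S_s) (sigma sigma' : 'S_n) :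
    (forall i : 'I_s, (i < k.+1)%N -> tau i = tau' i) ->
    (forall j : 'I_n, (j < k.+1)%N -> sigma j = sigma' j) ->
    f tau sigma = f tau' sigma' /\ ans tau sigma = ans tau' sigma'.
  move=> tauE sigmaE; split; last by rewrite /ans tauE ?sigmaE // ltnS fresh_le.
  by apply: f_loc => l lk; [apply: tauE | apply: sigmaE]; apply: ltnW.
transitivity (\sum_tau \sum_sigma
   (f tau sigma * (ans tau sigma)%:R *
      G (run (canon k.+1 tau1 sigma1 t1) (perm_samples tau sigma x)) +
    f tau sigma * (~~ ans tau sigma)%:R *
      G (run (canon k.+1 tau1 sigma1 t0) (perm_samples tau sigma x)))).
  apply: eq_bigr => tau _; apply: eq_bigr => sigma _.
  by rewrite /= perm_samplesE splitE.
transitivity (\sum_tau \sum_sigma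
   (f tau sigma * (ans tau sigma)%:R *
      G (run t1 (perm_samples (tau1 * tau)%g (sigma1 * sigma)%g x)) +
    f tau sigma * (~~ ans tau sigma)%:R *
      G (run t0 (perm_samples (tau1 * tau)%g (sigma1 * sigma)%g x)))).
  under eq_bigr do rewrite big_split; rewrite big_split /=.
  under [in RHS]eq_bigr do rewrite big_split; rewrite [RHS]big_split /=.
  congr (_ + _).
    apply: (IH1 _ _ _ (fun tau sigma => f tau sigma * (ans tau sigma)%:R)).
    by move=> ? ? ? ? hi hj; have [-> ->] := ans_loc _ _ _ _ hi hj.
  apply: (IH0 _ _ _ (fun tau sigma => f tau sigma * (~~ ans tau sigma)%:R)).
  by move=> ? ? ? ? hi hj; have [-> ->] := ans_loc _ _ _ _ hi hj.
apply: eq_bigr => tau _; apply: eq_bigr => sigma _.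
by rewrite /= perm_samplesE (permM tau1) (permM sigma1) splitE.
Qed.

End Canonical.

(** * Index permutations acting on distributions and on the Earth Mover Distance *)

Section Relabelling.
Variables (R : realType) (T : finType).

Lemma distr_ge0 (D : distr R T) x : 0 <= D x.
Proof. by case/andP: (dfunP D) => /forallP. Qed.

Lemma distr_sum (D : distr R T) : \sum_x D x = 1.
Proof. by case/andP: (dfunP D) => _ /eqP. Qed.

Lemma distr_ext (D E : distr R T) : D =1 E -> D = E.
Proof. by move=> DE; apply: val_inj; apply/ffunP. Qed.

Definition distr_comp (D : distr R T) (f : T -> T) (fb : bijective f) :
  distr R T.
Proof.
apply: (@Distr R T [ffun x => D (f x)]); apply/andP; split.
  by apply/forallP => x; rewrite ffunE distr_ge0.
apply/eqP; rewrite -(distr_sum D) [RHS](reindex f) /=; last exact: onW_bij.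
by apply: eq_bigr => x _; rewrite ffunE.
Defined.

End Relabelling.

(** This is [D_sigma], the law of [perm_bits sigma w] for [w] drawn from [D]; hence the inverse. *)
Definition perm_distr (R : realType) n (sigma : 'S_n) (D : distr R (bits n)) :
    distr R (bits n) := distr_comp D (perm_bits_bij sigma^-1).

Lemma perm_distrE (R : realType) n sigma (D : distr R (bits n)) w :
  perm_distr sigma D w = D (perm_bits sigma^-1 w).
Proof. by rewrite ffunE. Qed.

Lemma perm_distrK (R : realType) n sigma :
  cancel (@perm_distr R n sigma) (perm_distr sigma^-1).
Proof. by move=> D; apply: distr_ext => w; rewrite !perm_distrE perm_bitsVK. Qed.

Lemma perm_distrVK (R : realType) n sigma :
  cancel (@perm_distr R n sigma^-1) (perm_distr sigma).
Proof. by move=> D; apply: distr_ext => w; rewrite !perm_distrE perm_bitsK. Qed.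

Lemma perm_distr_invariant (R : realType) n (P : set (distr R (bits n)))
    sigma D :
  index_invariant P -> P D <-> P (perm_distr sigma D).
Proof.
by apply => w; rewrite perm_distrE -[in LHS](perm_bitsK sigma w).
Qed.

Lemma hamming_perm (R : realType) n (sigma : 'S_n) (x y : bits n) :
  hamming R (perm_bits sigma x) (perm_bits sigma y) = hamming R x y.
Proof.
rewrite /hamming; congr (_%:R / _).
rewrite -[RHS](card_preimset _ (@perm_inj _ sigma)).
by apply: eq_card => j; rewrite !inE !ffunE.
Qed.

(** Permuting both components of a coupling preserves its cost; the inverse permutation gives the
    converse inclusion of cost sets. *)
Lemma emd_perm (R : realType) n (sigma : 'S_n) (D E : distr R (bits n)) :
  emd (perm_distr sigma D) (perm_distr sigma E) = emd D E.
Proof.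
rewrite /emd; congr inf.
have sub (pi : 'S_n) (D' E' : distr R (bits n)) :
    [set \sum_x \sum_y c (x, y) * hamming R x y | c in coupling D' E'] `<=`
    [set \sum_x \sum_y c (x, y) * hamming R x y |
       c in coupling (perm_distr pi D') (perm_distr pi E')].
  move=> _ [c [cD cE] <-].
  pose f (z : bits n * bits n) := (perm_bits pi^-1 z.1, perm_bits pi^-1 z.2).
  have fb : bijective f.
    exists (fun z => (perm_bits pi z.1, perm_bits pi z.2)) => -[u v];
      by rewrite /f /= ?perm_bitsK ?perm_bitsVK.
  have reidx (F : bits n -> R) : \sum_y F (perm_bits pi^-1 y) = \sum_y F y.
    rewrite [RHS](reindex (perm_bits pi^-1)) //.
    by apply: onW_bij; exact: perm_bits_bij.
  exists (distr_comp c fb).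
    split=> w; rewrite perm_distrE -?cD -?cE.
      by rewrite -[RHS]reidx; apply: eq_bigr => v _; rewrite ffunE.
    by rewrite -[RHS]reidx; apply: eq_bigr => v _; rewrite ffunE.
  rewrite -[RHS]reidx; apply: eq_bigr => u _; rewrite -[RHS]reidx.
  by apply: eq_bigr => v _; rewrite ffunE hamming_perm.
apply/seteqP; split; last exact: sub.
by move=> z /(sub sigma^-1%g); rewrite !perm_distrK.
Qed.

(** Every [E] in [P] pulls back along [sigma] to a member of [P] that is as far from [D] as [E] is
    from [D_sigma]. Thus farness passes from [D] to [D_sigma]. *)
Lemma emd_to_perm (R : realType) n (P : set (distr R (bits n))) sigma D :
  index_invariant P -> (emd_to D P <= emd_to (perm_distr sigma D) P)%E.
Proof.
move=> hP; apply: le_ereal_inf_tmp => _ [E PE <-].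
rewrite -[in leRHS](perm_distrVK sigma E) emd_perm.
apply: ereal_inf_lbound; exists (perm_distr sigma^-1 E) => //.
exact: (perm_distr_invariant _ _ hP).1.
Qed.

(** [tau] disappears because the weight of i.i.d. samples does not depend on their order. *)
Lemma prob_perm (R : realType) n s (Omega : finType) (mu : distr R Omega)
    (D : distr R (bits n)) (B : Omega -> samples s n -> bool)
    (tau : 'S_s) (sigma : 'S_n) :
  prob mu D (fun w x => B w (perm_samples tau sigma x)) =
  prob mu (perm_distr sigma D) B.
Proof.
apply: eq_bigr => w _.
rewrite [RHS](reindex (perm_samples tau sigma)) /=; last first.
  exact/onW_bij/perm_samples_bij.
apply: eq_bigr => x _; congr (_ * _ * _).
rewrite (reindex_inj (@perm_inj _ tau)); apply: eq_bigr => i _.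
by rewrite perm_distrE ffunE perm_bitsK.
Qed.

(** * Averaging over uniform shuffles *)

Section Symmetrisation.
Variables (R : realType) (s n : nat) (Omega : finType) (mu : distr R Omega).

Let N : R := #|{: 'S_s * 'S_n}|%:R.

Let N_neq0 : N != 0.
Proof.
rewrite pnatr_eq0 -lt0n; apply/card_gt0P.
by exists (1%g : 'S_s, 1%g : 'S_n).
Qed.

Definition sym_coins : distr R (Omega * ('S_s * 'S_n))%type.
Proof.
apply: (@Distr R _ [ffun w => mu w.1 / N]); apply/andP; split.
  by apply/forallP => w; rewrite ffunE divr_ge0 ?distr_ge0 ?ler0n.
rewrite -(distr_sum mu); apply/eqP.
transitivity (\sum_u \sum_(v : 'S_s * 'S_n) mu u / N).
  by rewrite pair_bigA; apply: eq_bigr => w _; rewrite ffunE.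
apply: eq_bigr => w _.
by rewrite sumr_const -mulr_natr mulfVK.
Defined.

Lemma prob_sym (D : distr R (bits n))
    (B : Omega -> 'S_s -> 'S_n -> samples s n -> bool) :
  prob sym_coins D (fun w => B w.1 w.2.1 w.2.2) =
  N^-1 * \sum_w \sum_(x : samples s n) mu w * (\prod_(i < s) D (x i)) *
     \sum_tau \sum_sigma (B w tau sigma x)%:R.
Proof.
transitivity (\sum_w \sum_(v : 'S_s * 'S_n) \sum_(x : samples s n)
    mu w / N * (\prod_(i < s) D (x i)) * (B w v.1 v.2 x)%:R).
  rewrite pair_bigA; apply: eq_bigr => w _; apply: eq_bigr => x _.
  by rewrite ffunE.
rewrite mulr_sumr; apply: eq_bigr => w _.
rewrite exchange_big mulr_sumr; apply: eq_bigr => x _.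
rewrite pair_bigA !mulr_sumr /=; apply: eq_bigr => v _.
by ring.
Qed.

(** For fixed coins and samples, summing over all shuffles hides the relabelling. [h] is the
    identity for acceptance and [negb] for rejection. *)
Lemma prob_canon (A : Omega -> dtree s n) (D : distr R (bits n))
    (h : bool -> bool) :
  prob sym_coins D
    (fun w x => h (run (canon 0%N 1%g 1%g (A w.1)) (perm_samples w.2.1 w.2.2 x))) =
  N^-1 * \sum_(tau : 'S_s) \sum_(sigma : 'S_n)
     prob mu (perm_distr sigma D) (fun w x => h (run (A w) x)).
Proof.
rewrite (prob_sym D (fun w tau sigma x =>
  h (run (canon 0%N 1%g 1%g (A w)) (perm_samples tau sigma x)))); congr (_ * _).
under [RHS]eq_bigr => tau _ do under eq_bigr => sigma _ do
  rewrite -(prob_perm mu D (fun w x => h (run (A w) x)) tau sigma).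
rewrite [RHS]pair_bigA /= [RHS]exchange_big; apply: eq_bigr => w _ /=.
rewrite [RHS]exchange_big; apply: eq_bigr => x _ /=; rewrite -mulr_sumr; congr (_ * _).
(* Nothing is met yet, so [k = 0], the renamings are trivial and the weight is constant. *)
have := @sum_run_canon s n R (fun b => (h b)%:R) x (A w) 0%N 1%g 1%g (fun _ _ => 1).
move=> /(_ (fun _ _ _ _ _ _ => erefl)) /=.
under eq_bigr do under eq_bigr do rewrite mul1r.
under [X in _ = X -> _]eq_bigr do under eq_bigr do rewrite mul1r !mul1g.
by move=> ->; rewrite pair_bigA.
Qed.

Lemma prob_canon_ge (A : Omega -> dtree s n) (D : distr R (bits n)) h
    (a : R) :
    (forall sigma,
      a <= prob mu (perm_distr sigma D) (fun w x => h (run (A w) x))) ->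
  a <= prob sym_coins D
    (fun w x => h (run (canon 0%N 1%g 1%g (A w.1)) (perm_samples w.2.1 w.2.2 x))).
Proof.
move=> ha; rewrite (prob_canon A D h) mulrC ler_pdivlMr; last first.
  by rewrite lt_def N_neq0 ler0n.
rewrite pair_bigA /= /N mulr_natr -sumr_const.
by apply: ler_sum => v _; exact: ha.
Qed.

End Symmetrisation.

(** * The non-adaptive tester *)

Lemma card_ord_lt m q : (#|[set i : 'I_m | (i < q)%N]%SET| <= q)%N.
Proof.
rewrite cardE -(size_map val) -[leqRHS](size_iota 0).
apply: uniq_leq_size; first by rewrite (map_inj_uniq val_inj) enum_uniq.
by move=> _ /mapP[i + ->]; rewrite mem_enum inE mem_iota.
Qed.

Theorem theorem8p1 (R : realType) (n : nat) (eps : R)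
    (P : set (distr R (bits n))) (s q : nat)
    (hP : index_invariant P) (hA : adaptively_testable eps P s q) :
  exists m : nat,
    [/\ (m <= s * q)%N, (m <= q ^ 2)%N & nonadaptively_testable eps P s m].
Proof.
exists (minn s q * q)%N; split.
- by rewrite leq_mul2r geq_minl orbT.
- by rewrite expnS expn1 leq_mul2r geq_minr orbT.
case: hA => Omega [mu [A [depthA [accA rejA]]]].
(* The true indices behind the labels below [q]: the image of these labels under [p]. *)
pose block m (p : 'S_m) := [set i : 'I_m | (p^-1%g i < q)%N]%SET.
have card_block m (p : 'S_m) : (#|block m p| <= q)%N.
  apply: leq_trans (card_ord_lt m q).
  by rewrite -[leqRHS](card_preimset _ (@perm_inj _ p^-1%g)) subset_leq_card //;
    apply/fintype.subsetP => i; rewrite !inE.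
pose J (w : Omega * ('S_s * 'S_n)) i : {set 'I_n} :=
  if i \in block s w.2.1 then block n w.2.2 else finset.set0.
(* Unread bits default to [false]; by [viewE] this does not affect the run. *)
pose fill (v : {ffun 'I_s -> {ffun 'I_n -> option bool}}) : samples s n :=
  [ffun i => [ffun j => odflt false (v i j)]].
exists (Omega * ('S_s * 'S_n))%type, (sym_coins s n mu), J, (fun w v =>
  run (canon 0%N 1%g 1%g (A w.1)) (perm_samples w.2.1 w.2.2 (fill v))).
have viewE w x :
    run (canon 0%N 1%g 1%g (A w.1)) (perm_samples w.2.1 w.2.2 (fill (view (J w) x)))
    = run (canon 0%N 1%g 1%g (A w.1)) (perm_samples w.2.1 w.2.2 x).
  apply: run_canon_local => i j; rewrite add0n => hi hj.
  rewrite !ffunE /J !inE permK (leq_trans hi (depthA _)).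
  by rewrite inE permK (leq_trans hj (depthA _)).
have probE D h : prob (sym_coins s n mu) D (fun w x => h (run (canon 0%N 1%g 1%g (A w.1))
      (perm_samples w.2.1 w.2.2 (fill (view (J w) x))))) =
    prob (sym_coins s n mu) D (fun w x => h (run (canon 0%N 1%g 1%g (A w.1))
      (perm_samples w.2.1 w.2.2 x))).
  by apply: eq_bigr => w _; apply: eq_bigr => x _; rewrite viewE.
split.
  move=> w; rewrite (bigID (fun i => i \in block s w.2.1)) /=.
  rewrite [X in (_ + X)%N]big1 ?addn0; last first.
    by move=> i /negbTE hi; rewrite /J hi cards0.
  under eq_bigr => i hi do rewrite /J hi.
  rewrite sum_nat_const; apply: leq_mul; last exact: card_block.
  (* The block of samples also lies in ['I_s], whence the factor [minn s q]. *)
  rewrite leq_min card_block andbT.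
  by rewrite -[leqRHS]card_ord max_card.
split=> D hD.
  rewrite (probE D id); apply: (prob_canon_ge (h := id)) => sigma; apply: accA.
  exact: (perm_distr_invariant _ _ hP).1.
rewrite (probE D negb); apply: (prob_canon_ge (h := negb)) => sigma; apply: rejA.
exact: lt_le_trans hD (emd_to_perm _ _ hP).
Qed.
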